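(* Let $k$ be a field, $\Gamma$ an abelian group, $\gamma\in\Gamma$, $P$ a $\Gamma$-graded Poisson $k$-algebra, $\alpha$ a Poisson derivation of $P$ and $\delta$ a Poisson $\alpha$-derivation of $P$ such that $(\alpha,\delta)$ is $\gamma$-compatible. Let $B=P[t;\alpha,\delta]_{\mathrm p}$, graded by $B_\beta=\bigoplus_{n\ge0}P_{\beta\gamma^{-n}}t^n$ ($\beta\in\Gamma$). \begin{enumerate} \item[(1)] If $B$ is Poisson gr-simple, then $P$ is $(\alpha,\delta)$-Poisson gr-simple and $\delta$ is not $\alpha$-inner. \item[(2)] Suppose that $P$ is Poisson gr-simple. Then $B$ is Poisson gr-simple if and only if $B$ contains no homogeneous Poisson normal element of the form $t^n+\sum_{i<n}b_it^i$ with $n\ge1$ and $b_i\in P$. \item[(3)] Suppose that $P$ is Poisson gr-simple and $\operatorname{char}k=0$. Then $B$ is Poisson gr-simple if and only if $\delta$ is not $\alpha$-inner. \end{enumerate}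
   Context: Algebras are nonzero, associative, with identity. A Poisson algebra is a commutative $k$-algebra $P$ with a Lie bracket $\{-,-\}$ ($k$-bilinear) that is a derivation in each variable. It is $\Gamma$-graded if $P=\bigoplus_{\tau\in\Gamma}P_\tau$ (as $k$-vector space) with $P_\rho P_\tau\subseteq P_{\rho\tau}$ and $\{P_\rho,P_\tau\}\subseteq P_{\rho\tau}$ for all $\rho,\tau$. A Poisson ideal is an ideal $I$ with $\{P,I\}\subseteq I$; an ideal is graded if generated by homogeneous elements. $P$ is Poisson gr-simple if $0$ and $P$ are its only graded Poisson ideals; $P$ is $(\alpha,\delta)$-Poisson gr-simple if $0$ and $P$ are its only graded Poisson ideals $I$ with $\alpha(I)+\delta(I)\subseteq I$. An element $f\in B$ is Poisson normal if $\{B,f\}\subseteq fB$. A Poisson derivation is a ($k$-linear) derivation $\alpha$ of $P$ with $\alpha(\{a,b\})=\{\alpha(a),b\}+\{a,\alpha(b)\}$. A Poisson $\alpha$-derivation is a ($k$-linear) derivation $\delta$ of $P$ with $\delta(\{a,b\})=\{\delta(a),b\}+\{a,\delta(b)\}+\alpha(a)\delta(b)-\delta(a)\alpha(b)$ for $a,b\in P$. $P[t;\alpha,\delta]_{\mathrm p}$ denotes the polynomial algebra $P[t]$ with the unique Poisson bracket that extends the bracket of $P$ and satisfies $\{t,a\}=\alpha(a)t+\delta(a)$ for $a\in P$ (existence and uniqueness are known, by Oh). The pair $(\alpha,\delta)$ is $\gamma$-compatible if $\alpha(P_\tau)\subseteq P_\tau$ and $\delta(P_\tau)\subseteq P_{\gamma\tau}$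 for all $\tau\in\Gamma$; then the displayed decomposition of $B$ is a $\Gamma$-grading of the Poisson algebra $B$. For $u\in P$ put $\delta^{\mathrm p}_u(a)=\{u,a\}-u\alpha(a)$; $\delta$ is $\alpha$-inner if $\delta=\delta^{\mathrm p}_u$ for some $u\in P$. *)

(* Defs.v *)
From HB Require Import structures.
From mathcomp Require Import all_boot all_order all_algebra.
From mathcomp Require Import boolp classical_sets.

Set Implicit Arguments.
Unset Strict Implicit.
Unset Printing Implicit Defensive.

Import GRing.Theory.
Local Open Scope ring_scope.
Local Open Scope classical_set_scope.

(* MathComp equips {poly P} with its P-algebra structure only.  The alias
   kpoly P is the same ring, as a k-algebra by restriction of scalars. *)
Definition kpoly (k : fieldType) (P : comAlgType k) : Type := {poly P}.

Section KPoly.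
Variables (k : fieldType) (P : comAlgType k).

HB.instance Definition _ := GRing.ComNzRing.on (kpoly P).

Definition kpoly_scale (c : k) (p : kpoly P) : kpoly P :=
  (c%:A : P) *: (p : {poly P}).

Fact kpoly_scaleA c d p :
  kpoly_scale c (kpoly_scale d p) = kpoly_scale (c * d) p.
Proof. by rewrite /kpoly_scale scalerA -scalerAl mul1r scalerA. Qed.

Fact kpoly_scale1 : left_id 1 kpoly_scale.
Proof. by move=> p; rewrite /kpoly_scale !scale1r. Qed.

Fact kpoly_scaleDr : right_distributive kpoly_scale +%R.
Proof. by move=> c p q; rewrite /kpoly_scale scalerDr. Qed.

Fact kpoly_scaleDl p : {morph kpoly_scale^~ p : c d / c + d}.
Proof. by move=> c d; rewrite /kpoly_scale !scalerDl. Qed.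

HB.instance Definition _ := GRing.Zmodule_isLmodule.Build k (kpoly P)
  kpoly_scaleA kpoly_scale1 kpoly_scaleDr kpoly_scaleDl.

Fact kpoly_scaleAl (c : k) (p q : kpoly P) : c *: (p * q) = c *: p * q.
Proof. exact: (@scalerAl _ {poly P}). Qed.

HB.instance Definition _ :=
  GRing.Lmodule_isLalgebra.Build k (kpoly P) kpoly_scaleAl.

Fact kpoly_scaleAr (c : k) (p q : kpoly P) : c *: (p * q) = p * (c *: q).
Proof. exact: (@scalerAr _ {poly P}). Qed.

HB.instance Definition _ :=
  GRing.Lalgebra_isAlgebra.Build k (kpoly P) kpoly_scaleAr.

End KPoly.

Section PoissonAlgebras.
Variables (k : fieldType) (A : comAlgType k).

Definition is_derivation (d : A -> A) : Prop :=
  linear d /\ forall a b, d (a * b) = d a * b + a * d b.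

Record poisson_bracket (br : A -> A -> A) : Prop := PoissonBracket {
  pbr_alternating : forall a, br a a = 0;
  pbr_jacobi : forall a b c,
    br a (br b c) + br b (br c a) + br c (br a b) = 0;
  pbr_derivation_l : forall b, is_derivation (fun a => br a b);
  pbr_derivation_r : forall a, is_derivation (br a)
}.

Definition poisson_derivation (br : A -> A -> A) (alpha : A -> A) : Prop :=
  is_derivation alpha /\
  forall a b, alpha (br a b) = br (alpha a) b + br a (alpha b).

Definition poisson_alpha_derivation (br : A -> A -> A)
    (alpha delta : A -> A) : Prop :=
  is_derivation delta /\
  forall a b, delta (br a b) =
    br (delta a) b + br a (delta b) + alpha a * delta b - delta a * alpha b.

Definition inner_poisson_derivation (br : A -> A -> A) (alpha : A -> A)
    (u : A) : A -> A :=
  fun a => br u a - u * alpha a.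

Definition alpha_inner (br : A -> A -> A) (alpha delta : A -> A) : Prop :=
  exists u, forall a, delta a = inner_poisson_derivation br alpha u a.

Definition poisson_normal (br : A -> A -> A) (f : A) : Prop :=
  forall b, exists c, br b f = f * c.

Definition is_ideal (I : set A) : Prop :=
  [/\ I 0, forall x y, I x -> I y -> I (x + y) &
      forall a x, I x -> I (a * x)].

Definition is_poisson_ideal (br : A -> A -> A) (I : set A) : Prop :=
  is_ideal I /\ forall a x, I x -> I (br a x).

(* Gradings are indexed by an abelian group written additively. *)
Variable Gamma : zmodType.

Definition is_subspace (V : set A) : Prop :=
  V 0 /\ forall (c : k) x y, V x -> V y -> V (c *: x + y).

(* A is the internal direct sum of the subspaces G tau. *)
Definition direct_sum_decomposition (G : Gamma -> set A) : Prop :=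
  [/\ forall tau, is_subspace (G tau),
      forall x, exists (s : seq Gamma) (f : Gamma -> A),
        [/\ uniq s, forall tau, G tau (f tau) & x = \sum_(tau <- s) f tau] &
      forall (s : seq Gamma) (f : Gamma -> A), uniq s ->
        (forall tau, G tau (f tau)) -> \sum_(tau <- s) f tau = 0 ->
        forall tau, tau \in s -> f tau = 0].

Definition poisson_grading (br : A -> A -> A) (G : Gamma -> set A) : Prop :=
  [/\ direct_sum_decomposition G,
      forall rho tau a b, G rho a -> G tau b -> G (rho + tau) (a * b) &
      forall rho tau a b, G rho a -> G tau b -> G (rho + tau) (br a b)].

Definition homogeneous (G : Gamma -> set A) (a : A) : Prop :=
  exists tau, G tau a.

Definition is_graded_ideal (G : Gamma -> set A) (I : set A) : Prop :=
  exists2 S : set A, S `<=` homogeneous G & I = smallest is_ideal S.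

Definition poisson_gr_simple (br : A -> A -> A) (G : Gamma -> set A) : Prop :=
  forall I : set A, is_poisson_ideal br I -> is_graded_ideal G I ->
    I = [set 0] \/ I = setT.

Definition ad_poisson_gr_simple (br : A -> A -> A) (G : Gamma -> set A)
    (alpha delta : A -> A) : Prop :=
  forall I : set A, is_poisson_ideal br I -> is_graded_ideal G I ->
    (forall x y, I x -> I y -> I (alpha x + delta y)) ->
    I = [set 0] \/ I = setT.

Definition compatible (G : Gamma -> set A) (gamma : Gamma)
    (alpha delta : A -> A) : Prop :=
  forall tau, alpha @` G tau `<=` G tau /\ delta @` G tau `<=` G (gamma + tau).

End PoissonAlgebras.

Section PoissonOreExtension.
Variables (k : fieldType) (P : comAlgType k).

(* brB makes P[t] into the Poisson polynomial algebra P[t; alpha, delta]_p;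
   such a bracket exists and is unique when alpha is a Poisson derivation and
   delta a Poisson alpha-derivation. *)
Record poisson_ore_bracket (br : P -> P -> P) (alpha delta : P -> P)
    (brB : kpoly P -> kpoly P -> kpoly P) : Prop := PoissonOreBracket {
  ore_poisson : poisson_bracket brB;
  ore_extends : forall a b : P, brB a%:P b%:P = (br a b)%:P;
  ore_var : forall a : P, brB 'X a%:P = (alpha a)%:P * 'X + (delta a)%:P
}.

Variable Gamma : zmodType.

Definition ore_grading (G : Gamma -> set P) (gamma : Gamma) :
    Gamma -> set (kpoly P) :=
  fun beta => [set p : {poly P} | forall n, G (beta - gamma *+ n) p`_n].

End PoissonOreExtension.

(* Main.v *)
Require Import Defs.
From mathcomp Require Import all_boot all_order all_algebra.
From mathcomp Require Import boolp classical_sets.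
From mathcomp Require Import ring.
Import GRing.Theory.
Local Open Scope ring_scope.
Local Open Scope classical_set_scope.
Set Implicit Arguments.
Unset Strict Implicit.
Unset Printing Implicit Defensive.

(** Why the theorem holds.

    Bracketing with a constant [a] does not raise the degree in [t], and
    bracketing with [t] acts on coefficients by [alpha] (with a shift) and
    [delta]; see [coef_bracket_const] and [coef_bracket_var].

    A nonzero proper graded Poisson ideal of [B] can arise in two ways.  It can
    be extended from [P]: if [I] is a graded Poisson ideal of [P] stable under
    [alpha] and [delta], the polynomials with coefficients in [I] form one
    ([coefficient_ideal_poisson]).  It can also be generated by a monic
    homogeneous Poisson normal element [f] of positive degree: [fB] is then a
    graded Poisson ideal, and it is proper because [f] is monic
    ([monic_normal_not_gr_simple]).  If [delta] is the inner derivation given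
    by [u], then [u] can be replaced by its component of degree [gamma]
    ([alpha_inner_homogeneous]) and [t - u] is such an [f].

    Conversely, let [P] be Poisson gr-simple and [I] a nonzero graded Poisson
    ideal of [B].  The leading coefficients of the elements of [I] of least
    degree form, with [0], a nonzero graded Poisson ideal of [P], hence contain
    [1].  A homogeneous component of a monic element of least degree is still
    monic ([minimal_degree_monic]), and it is Poisson normal because dividing
    [{b, f}] by [f] leaves a remainder in [I] of too small a degree
    ([minimal_degree_normal]).  So either [I = B] or [B] contains a monic
    homogeneous Poisson normal element of positive degree.

    Finally, let [f = t^n + b t^(n-1) + ...] with [n >= 1] be Poisson normal.
    Comparing degrees, [{a, f} = f c] with [c] in [P]; the coefficients of [t^n]
    and [t^(n-1)] give [c = - n alpha(a)] and
    [n delta(a) = {a, b} + b alpha(a)].  In characteristic zero this says that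
    [delta] is inner, given by [- b / n] ([monic_normal_inner]). *)

(** * Homogeneous decompositions *)

Section Decompositions.
Variables (k : fieldType) (A : comAlgType k) (Gamma : zmodType).
Implicit Types (G : Gamma -> set A) (x y : A) (c d : Gamma -> A).

(** The family [c] is the family of homogeneous components of [x].  Finiteness
    of its support is encoded by asking [x] to be the sum over every large enough
    list of degrees: two families can then be compared on a common list. *)
Definition decomposes G x c : Prop :=
  (forall tau, G tau (c tau)) /\
  exists s : seq Gamma, forall t, uniq t -> {subset s <= t} ->
    x = \sum_(tau <- t) c tau.

Lemma decomposes_sum G x c : decomposes G x c ->
  exists2 s : seq Gamma, uniq s & x = \sum_(tau <- s) c tau.
Proof.
case=> _ [s hs]; exists (undup s); first exact: undup_uniq.
by apply: hs; [exact: undup_uniq | move=> tau; rewrite mem_undup].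
Qed.

Section DirectSum.
Variables (G : Gamma -> set A) (hG : direct_sum_decomposition G).

Lemma piece0 tau : G tau 0.
Proof. by case: hG => /(_ tau) []. Qed.

Lemma pieceD tau x y : G tau x -> G tau y -> G tau (x + y).
Proof.
by move=> hx hy; case: hG => /(_ tau) [_ /(_ 1 x y hx hy)]; rewrite scale1r.
Qed.

Lemma pieceN tau x : G tau x -> G tau (- x).
Proof.
move=> hx; case: hG => /(_ tau) [h0 /(_ (-1) x 0 hx h0)].
by rewrite scaleN1r addr0.
Qed.

Lemma piece_sum tau (I : Type) (r : seq I) (F : I -> A) :
  (forall i, G tau (F i)) -> G tau (\sum_(i <- r) F i).
Proof.
move=> h; elim/big_ind: _ => //; [exact: piece0 | exact: pieceD].
Qed.

Lemma sum_superset (s t : seq Gamma) (f : Gamma -> A) :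
  uniq s -> uniq t -> {subset s <= t} ->
  \sum_(tau <- t) (if tau \in s then f tau else 0) = \sum_(tau <- s) f tau.
Proof.
move=> us ut st; rewrite -big_mkcond -big_filter; apply: perm_big.
apply: uniq_perm => //; first exact: filter_uniq.
by move=> tau; rewrite mem_filter andb_idr //; apply: st.
Qed.

Lemma exists_decomposition x : exists c, decomposes G x c.
Proof.
case: (hG) => _ /(_ x) [s [f [us Gf ->]]] _.
exists (fun tau => if tau \in s then f tau else 0); split.
  by move=> tau; case: ifP => // _; apply: piece0.
by exists s => t ut st; rewrite sum_superset.
Qed.

Lemma decomposition_unique x c d :
  decomposes G x c -> decomposes G x d -> c =1 d.
Proof.
case=> Gc [s hs] [Gd [s' hs']] tau; apply/eqP; rewrite -subr_eq0; apply/eqP.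
case: (hG) => _ _ indep.
apply: (indep (undup (tau :: s ++ s')) (fun rho => c rho - d rho)).
- exact: undup_uniq.
- by move=> rho; apply: pieceD => //; apply: pieceN.
- rewrite sumrB -hs -?hs' ?subrr ?undup_uniq // => rho hrho.
    by rewrite mem_undup inE mem_cat hrho !orbT.
  by rewrite mem_undup inE mem_cat hrho orbT.
- by rewrite mem_undup mem_head.
Qed.

Lemma decomposesD x y c d : decomposes G x c -> decomposes G y d ->
  decomposes G (x + y) (fun tau => c tau + d tau).
Proof.
case=> Gc [s hs] [Gd [s' hs']]; split; first by move=> tau; apply: pieceD.
exists (s ++ s') => t ut st; rewrite big_split /= -hs -?hs' // => rho hrho;
  by apply: st; rewrite mem_cat hrho ?orbT.
Qed.

Lemma decomposes_homogeneous tau x : G tau x ->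
  decomposes G x (fun rho => if rho == tau then x else 0).
Proof.
move=> Gx; split; first by move=> rho; case: eqP => [->|_] //; apply: piece0.
exists [:: tau] => t ut st.
rewrite -[LHS](big_seq1 +%R tau (fun=> x)) -(sum_superset _ _ ut st) //.
by apply: eq_bigr => rho _; rewrite inE.
Qed.

Lemma decomposes0 : decomposes G 0 (fun=> 0).
Proof.
by split; [exact: piece0 | exists [::] => t _ _; rewrite big1].
Qed.

End DirectSum.

(** The elimination principle of a graded algebra: additive properties need be
    checked on homogeneous elements only. *)
Lemma homogeneous_ind G (K : A -> Prop) : direct_sum_decomposition G ->
  K 0 -> (forall x y, K x -> K y -> K (x + y)) ->
  (forall tau x, G tau x -> K x) -> forall x, K x.
Proof.
move=> hG K0 KD Khom x; have [c hc] := exists_decomposition hG x.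
have [s _ ->] := decomposes_sum hc.
by elim/big_ind: _ => // tau _; apply: (Khom tau); apply: (proj1 hc).
Qed.

End Decompositions.

(** Additive maps that shift degrees commute with taking components.  This one
    fact serves multiplication and bracketing by a homogeneous element as well as
    extraction of a coefficient of a polynomial. *)
Lemma decomposes_shift (k : fieldType) (A A' : comAlgType k)
    (Gamma : zmodType) (G : Gamma -> set A) (G' : Gamma -> set A')
    (F : A -> A') (rho : Gamma) x c :
  {morph F : x y / x + y} ->
  (forall tau a, G tau a -> G' (tau + rho) (F a)) ->
  decomposes G x c -> decomposes G' (F x) (fun tau => F (c (tau - rho))).
Proof.
move=> FD FG [Gc [s hs]].
have F0 : F 0 = 0 by apply: (addrI (F 0)); rewrite -FD !addr0.
split; first by move=> tau; rewrite -{1}(subrK rho tau); apply: FG.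
exists [seq tau + rho | tau <- s] => t ut st.
rewrite (hs [seq tau - rho | tau <- t]).
- by rewrite (big_morph F FD F0) big_map.
- by rewrite map_inj_uniq //; apply: addIr.
move=> tau hs'; apply/mapP; exists (tau + rho); last by rewrite addrK.
by apply/st/map_f.
Qed.

(** * Graded ideals *)

Section GradedIdeals.
Variables (k : fieldType) (A : comAlgType k) (Gamma : zmodType).
Variables (G : Gamma -> set A).
Hypothesis hG : direct_sum_decomposition G.
Hypothesis hGM : forall rho tau a b,
  G rho a -> G tau b -> G (rho + tau) (a * b).

(** Comparing components in [a * 1 = a] for homogeneous [a] shows that the
    component of [1] of degree [0] is itself an identity element. *)
Lemma unit_homogeneous : G 0 1.
Proof.
have [c hc] := exists_decomposition hG 1.
suff h (a : A) : a * c 0 = a by rewrite -(h 1) mul1r; apply: (proj1 hc).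
move: a; apply: (homogeneous_ind hG) => [|x y hx hy|tau a Ga].
- by rewrite mul0r.
- by rewrite mulrDl hx hy.
have hac : decomposes G a (fun sigma => a * c (sigma - tau)).
  rewrite -{1}[a]mulr1; apply: (decomposes_shift _ _ hc) => [x y|sigma x Gx].
    by rewrite mulrDr.
  by rewrite addrC; apply: hGM.
have := decomposition_unique hG hac (decomposes_homogeneous hG Ga) tau.
by rewrite subrr eqxx.
Qed.

Lemma ideal_sum (I : set A) (T : Type) (r : seq T) (F : T -> A) :
  is_ideal I -> (forall i, I (F i)) -> I (\sum_(i <- r) F i).
Proof. by case=> I0 ID _ h; elim/big_ind: _. Qed.

Lemma ideal_opp (I : set A) x : is_ideal I -> I x -> I (- x).
Proof. by case=> _ _ IM /(IM (-1)); rewrite mulN1r. Qed.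

Lemma ideal_eq_setT (I : set A) : is_ideal I -> I 1 -> I = setT.
Proof.
by case=> _ _ IM I1; apply/seteqP; split=> // x _; rewrite -[x]mulr1; apply: IM.
Qed.

(** The elements of [A] all of whose components lie in [I] form an ideal, and
    this ideal contains the homogeneous generators of [I]. *)
Lemma graded_ideal_component (I : set A) x c :
  is_graded_ideal G I -> decomposes G x c -> I x -> forall tau, I (c tau).
Proof.
case=> S Shom ->.
set J := smallest _ S => hc.
have SJ : S `<=` J by apply: sub_gen_smallest.
have [J0 JD JM] : is_ideal J.
  split=> [|x1 y1 h1 h2|a x1 h1] M [Mid SM]; have [M0 MD MM] := Mid => //.
    by apply: MD; [apply: h1|apply: h2].
  by apply: MM; apply: h1.
pose K : set A := [set y | forall d, decomposes G y d -> forall tau, J (d tau)].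
have KD y z : K y -> K z -> K (y + z).
  move=> Ky Kz d hd tau.
  have [d1 hd1] := exists_decomposition hG y.
  have [d2 hd2] := exists_decomposition hG z.
  rewrite (decomposition_unique hG hd (decomposesD hG hd1 hd2)).
  by apply: JD; [apply: Ky|apply: Kz].
have K0 : K 0.
  by move=> d hd tau; rewrite (decomposition_unique hG hd (decomposes0 hG)).
suff KI : is_ideal K.
  move=> Jx; have: K x by apply: smallest_sub Jx => // y Sy d hd tau;
    have [rho Gy] := Shom _ Sy;
    rewrite (decomposition_unique hG hd (decomposes_homogeneous hG Gy));
    case: eqP => // _; apply: SJ.
  by apply.
split=> // a y Ky; move: a; apply: (homogeneous_ind hG) => [|a b ha hb|rho a Ga].
- by rewrite mul0r.
- by rewrite mulrDl; apply: KD.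
move=> d hd tau; have [e he] := exists_decomposition hG y.
have hae : decomposes G (a * y) (fun sigma => a * e (sigma - rho)).
  apply: (decomposes_shift _ _ he) => [u v|sigma u Gu]; first by rewrite mulrDr.
  by rewrite addrC; apply: hGM.
by rewrite (decomposition_unique hG hd hae); apply: JM; apply: Ky.
Qed.

(** Every element of [I] is the sum of its components, which are homogeneous
    elements of [I]. *)
Lemma graded_idealP (I : set A) : is_ideal I ->
  (forall x c, decomposes G x c -> I x -> forall tau, I (c tau)) ->
  is_graded_ideal G I.
Proof.
move=> Iid Ic; exists (I `&` homogeneous G); first by move=> x [].
apply/seteqP; split; last by apply: smallest_sub => // x [].
move=> x Ix M [Mid SM]; have [c hc] := exists_decomposition hG x.
have [s _ ->] := decomposes_sum hc.
apply: ideal_sum => // tau; apply: SM; split; first exact: Ic hc Ix tau.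
by exists tau; apply: (proj1 hc).
Qed.

Definition principal (f : A) : set A := [set g | exists c, g = f * c].

Lemma principal_ideal f : is_ideal (principal f).
Proof.
split=> [|_ _ [c ->] [d ->]|a _ [c ->]].
- by exists 0; rewrite mulr0.
- by exists (c + d); rewrite mulrDr.
- by exists (a * c); rewrite mulrCA.
Qed.

Lemma principal_graded f : homogeneous G f -> is_graded_ideal G (principal f).
Proof.
move=> Gf; exists [set f]; first by move=> _ ->.
apply/seteqP; split; last first.
  apply: smallest_sub; first exact: principal_ideal.
  by move=> _ ->; exists 1; rewrite mulr1.
by move=> _ [c ->] M [[_ _ MM] SM]; rewrite mulrC; apply/MM/SM.
Qed.

End GradedIdeals.

(** * Derivations and Poisson normal elements *)

Section Derivations.
Variables (k : fieldType) (A : comAlgType k).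

Lemma derivationD (d : A -> A) : is_derivation d -> {morph d : x y / x + y}.
Proof. by move=> [hl _] x y; rewrite -[x]scale1r hl !scale1r. Qed.

Lemma derivation0 (d : A -> A) : is_derivation d -> d 0 = 0.
Proof.
by move=> hd; apply: (addrI (d 0)); rewrite -derivationD // !addr0.
Qed.

Lemma derivationZ (d : A -> A) c x : is_derivation d -> d (c *: x) = c *: d x.
Proof. by move=> hd; rewrite -[c *: x]addr0 (proj1 hd) derivation0 // addr0. Qed.

Lemma derivationN (d : A -> A) : is_derivation d -> {morph d : x / - x}.
Proof. by move=> hd x; rewrite -!scaleN1r derivationZ. Qed.

Lemma derivation1 (d : A -> A) : is_derivation d -> d 1 = 0.
Proof.
move=> hd; apply: (addrI (d 1)).
by rewrite addr0 -[in RHS](mulr1 1) (proj2 hd) mulr1 mul1r.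
Qed.

Lemma bracketC (br : A -> A -> A) a b : poisson_bracket br ->
  br a b = - br b a.
Proof.
move=> [alt _ dl dr]; apply/eqP; rewrite -addr_eq0; apply/eqP.
have := alt (a + b); rewrite (derivationD (dr _)) !(derivationD (dl _)) !alt.
by rewrite add0r addr0 addrC.
Qed.

(** Normality of [f] absorbs the term [{a, f} c] of [{a, f c}] into [fA]. *)
Lemma principal_poisson (br : A -> A -> A) f : poisson_bracket br ->
  poisson_normal br f -> is_poisson_ideal br (principal f).
Proof.
move=> hbr hf; split; first exact: principal_ideal.
move=> a _ [c ->]; have [e he] := hf a.
rewrite (proj2 (pbr_derivation_r hbr a)) he.
by exists (e * c + br a c); rewrite mulrDr mulrA.
Qed.

Lemma normal_generator_trivial (Gamma : zmodType) (br : A -> A -> A)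
    (G : Gamma -> set A) f :
  poisson_bracket br -> poisson_gr_simple br G -> homogeneous G f ->
  poisson_normal br f -> f = 0 \/ exists c, 1 = f * c.
Proof.
move=> hbr simple Gf nf.
have [h0|hT] := simple _ (principal_poisson hbr nf) (principal_graded Gf).
  have : principal f f by exists 1; rewrite mulr1.
  by rewrite h0 => ->; left.
by right; have : principal f 1 by rewrite hT.
Qed.

End Derivations.

(** * The grading of the Poisson polynomial algebra *)

Section OreGrading.
Variables (k : fieldType) (P : comAlgType k) (Gamma : zmodType).
Variables (G : Gamma -> set P) (gamma : Gamma).
Hypothesis hG : direct_sum_decomposition G.
Hypothesis hGM : forall rho tau a b,
  G rho a -> G tau b -> G (rho + tau) (a * b).
Let GB : Gamma -> set (kpoly P) := ore_grading G gamma.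

(** Everything is read off coefficientwise: the coefficient of [t^n] of an
    element of degree [beta] has degree [beta - n gamma], so for each fixed [n] the
    shift by [n gamma] reduces the claim to the decomposition of [P]. *)
Lemma ore_grading_direct_sum : direct_sum_decomposition GB.
Proof.
split=> [tau|p|s f us Gf sf0 tau hs].
- split=> [n|c p q hp hq n]; first by rewrite /= coef0; apply: piece0.
  case: (hG) => /(_ (tau - gamma *+ n)) [_ Glin] _ _.
  have -> : (c *: p + q : {poly P})`_n = c *: (p : {poly P})`_n + q`_n.
    by rewrite coefD; congr (_ + _); rewrite [LHS]coefZ -scalerAl mul1r.
  exact: Glin.
- have [C hC] := choice (fun n => exists_decomposition hG (p : {poly P})`_n).
  have [S hS] := choice (fun n => proj2 (hC n)).
  pose f beta : {poly P} :=
    \poly_(n < size (p : {poly P})) C n (beta - gamma *+ n).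
  pose s := flatten [seq [seq tau + gamma *+ n | tau <- S n]
                    | n <- iota 0 (size (p : {poly P}))].
  exists (undup s), f; split; first exact: undup_uniq.
    move=> tau n; rewrite /f coef_poly; case: ifP => _; last exact: piece0.
    exact: (proj1 (hC n)).
  apply/polyP => n; rewrite (coef_sum (undup s) xpredT f n).
  under eq_bigr => i _ do rewrite coef_poly.
  case: ltnP => hn; last by rewrite big1 // nth_default.
  rewrite -(big_map (fun beta => beta - gamma *+ n) xpredT (C n)).
  apply: hS => [|tau htau].
    by rewrite map_inj_uniq ?undup_uniq //; apply: addIr.
  apply/mapP; exists (tau + gamma *+ n); last by rewrite addrK.
  rewrite mem_undup; apply/flatten_mapP; exists n; first by rewrite mem_iota.
  exact: map_f.
apply/polyP => n; rewrite coef0; case: (hG) => _ _ indep.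
have := indep [seq beta - gamma *+ n | beta <- s]
  (fun beta => (f (beta + gamma *+ n) : {poly P})`_n).
move=> /(_ _ _ _ (tau - gamma *+ n)); rewrite subrK; apply.
- by rewrite map_inj_uniq //; apply: addIr.
- by move=> beta; have := Gf (beta + gamma *+ n) n; rewrite addrK.
- rewrite big_map; under eq_bigr => i _ do rewrite subrK.
  have sfn := congr1 (fun q : kpoly P => (q : {poly P})`_n) sf0.
  exact: etrans (esym (coef_sum s xpredT f n)) (etrans sfn (coef0 _ _)).
- exact: (map_f (fun beta => beta - gamma *+ n)).
Qed.

Lemma ore_gradingM rho tau (p q : kpoly P) :
  GB rho p -> GB tau q -> GB (rho + tau) (p * q).
Proof.
move=> hp hq n; rewrite [X in G _ X]coefM; apply: (piece_sum hG) => i.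
have -> : rho + tau - gamma *+ n =
    (rho - gamma *+ i) + (tau - gamma *+ (n - i)).
  by rewrite addrACA -opprD -mulrnDr subnKC // -ltnS.
exact: hGM.
Qed.

Lemma decomposes_coef (p : {poly P}) (c : Gamma -> {poly P}) n :
  decomposes GB p c ->
  decomposes G p`_n (fun tau => (c (tau + gamma *+ n))`_n).
Proof.
move=> hc; have := decomposes_shift (A' := P) (G' := G)
  (F := fun q : kpoly P => (q : {poly P})`_n) (rho := - (gamma *+ n)) _ _ hc.
rewrite /=; under [X in decomposes G _ X]eq_fun do rewrite opprK.
by apply=> [x y|tau q]; [exact: coefD | apply].
Qed.

Lemma decomposes_size (p : {poly P}) (c : Gamma -> {poly P}) tau :
  decomposes GB p c -> (size (c tau) <= size p)%N.
Proof.
move=> hc; apply/leq_sizeP => n hn.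
have := decomposes_coef n hc; rewrite (nth_default _ hn) => hcn.
have := decomposition_unique hG hcn (decomposes0 hG) (tau - gamma *+ n).
by rewrite subrK.
Qed.

End OreGrading.

(** * The bracket of the Poisson polynomial algebra *)

Section OreBracket.
Variables (k : fieldType) (P : comAlgType k).
Variables (br : P -> P -> P) (alpha delta : P -> P).
Variables (brB : kpoly P -> kpoly P -> kpoly P).
Hypothesis hbr : poisson_bracket br.
Hypothesis alpha_der : is_derivation alpha.
Hypothesis delta_der : is_derivation delta.
Hypothesis hB : poisson_ore_bracket br alpha delta brB.
Implicit Types (p q : {poly P}) (a b : P).

Let hP : poisson_bracket brB := ore_poisson hB.

Lemma ore_bracketDr p q1 q2 : brB p (q1 + q2) =
  (brB p q1 + brB p q2) :> {poly P}.
Proof. exact: derivationD (pbr_derivation_r hP p) _ _. Qed.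

Lemma ore_bracketMr p q1 q2 :
  brB p (q1 * q2) = (brB p q1 * q2 + q1 * brB p q2) :> {poly P}.
Proof. exact: proj2 (pbr_derivation_r hP p) _ _. Qed.

Lemma ore_bracketDl p q1 q2 : brB (q1 + q2) p =
  (brB q1 p + brB q2 p) :> {poly P}.
Proof. exact: derivationD (pbr_derivation_l hP p) _ _. Qed.

Lemma ore_bracketMl p q1 q2 :
  brB (q1 * q2) p = (brB q1 p * q2 + q1 * brB q2 p) :> {poly P}.
Proof. exact: proj2 (pbr_derivation_l hP p) _ _. Qed.

(** From [{a, t} = - alpha(a) t - delta(a)] and the Leibniz rule: the three terms
    come from differentiating the coefficient and, twice, the power of [t]. *)
Lemma coef_bracket_const a p n :
  (brB a%:P p : {poly P})`_n =
    br a p`_n - p`_n *+ n * alpha a - p`_n.+1 *+ n.+1 * delta a.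
Proof.
have brCX : brB a%:P 'X = - ((alpha a)%:P * 'X + (delta a)%:P) :> {poly P}.
  by rewrite (bracketC _ _ hP) (ore_var hB).
have br_der : is_derivation (br a).
  exact: pbr_derivation_r.
elim/poly_ind: p n => [|p c IH] n.
  rewrite [brB _ _](derivation0 (pbr_derivation_r hP a%:P)) !coef0 derivation0 //.
  by rewrite !mul0rn !mul0r !subr0.
rewrite ore_bracketDr ore_bracketMr brCX (ore_extends hB) mulrN mulrDr mulrA.
rewrite !coefD coefN coefD !coefMX !coefMC !coefC.
case: n => [|n] /=; first by rewrite addr0 !add0r; ring.
by rewrite IH !addr0 !mulrS; ring.
Qed.

Lemma coef_bracket_var p n :
  (brB 'X p : {poly P})`_n =
    (if n == 0%N then 0 else alpha p`_n.-1) + delta p`_n.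
Proof.
have brXX : brB 'X 'X = 0 :> {poly P} by apply: (pbr_alternating hP).
elim/poly_ind: p n => [|p c IH] n.
  rewrite [brB _ _](derivation0 (pbr_derivation_r hP 'X)) !coef0.
  by rewrite (derivation0 alpha_der) (derivation0 delta_der) if_same addr0.
rewrite ore_bracketDr ore_bracketMr brXX mulr0 addr0 (ore_var hB).
rewrite !coefD !coefMX !coefC !(derivationD alpha_der) !(derivationD delta_der).
case: n => [|[|n]] /=; rewrite ?IH /= ?(derivation0 alpha_der)
  ?(derivation0 delta_der) ?addr0 ?add0r //.
by rewrite addrC.
Qed.

(** [B] is generated by [P] and [t], and the elements [g] with [{g, f}] in [I]
    form a subalgebra by the Leibniz rule. *)
Lemma ore_bracket_in_ideal (I : set (kpoly P)) (f : kpoly P) : is_ideal I ->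
  (forall a, I (brB a%:P f)) -> I (brB 'X f) -> forall g, I (brB g f).
Proof.
move=> [I0 ID IM] hC hX; elim/poly_ind => [|p c IH].
  by rewrite (derivation0 (pbr_derivation_l hP f)).
rewrite [brB _ _]ore_bracketDl ore_bracketMl; apply: (ID) => //; apply: ID.
  by rewrite [X in I X]mulrC; apply: IM.
exact: IM.
Qed.

Lemma coefficient_ideal_poisson (I : set P) : is_poisson_ideal br I ->
  (forall x y, I x -> I y -> I (alpha x + delta y)) ->
  is_poisson_ideal brB [set p : {poly P} | forall n, I p`_n].
Proof.
move=> [Iid Ibr] Iad; have [I0 ID IM] := Iid.
have Ia x : I x -> I (alpha x).
  by move=> Ix; have := Iad _ _ Ix I0; rewrite (derivation0 delta_der) addr0.
have Id x : I x -> I (delta x).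
  by move=> Ix; have := Iad _ _ I0 Ix; rewrite (derivation0 alpha_der) add0r.
have Jid : is_ideal (A := kpoly P) [set p : {poly P} | forall n, I p`_n].
  split=> [n|p q hp hq n|p q hq n]; first by rewrite /= coef0.
    by rewrite [X in I X]coefD; apply: ID.
  by rewrite [X in I X]coefM; apply: ideal_sum => // i; apply: IM.
split=> // b f hf; move: b; apply: ore_bracket_in_ideal => // [a|] n.
  rewrite [X in I X]coef_bracket_const; apply: (ID); first apply: (ID) => //.
  - exact: Ibr.
  - by apply: ideal_opp => //; rewrite mulrC mulrnAr -mulrnAl; apply: IM.
  - by apply: ideal_opp => //; rewrite mulrC mulrnAr -mulrnAl; apply: IM.
rewrite [X in I X]coef_bracket_var; apply: ID; last exact: Id.
by case: ifP => // _; apply: Ia.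
Qed.

End OreBracket.

(** * Monic polynomials *)

Section MonicPolynomials.
Variable P : comNzRingType.
Implicit Types f g : {poly P}.

Lemma size_tail n (b : 'I_n -> P) :
  (size (\sum_(i < n) (b i)%:P * 'X^i)%R <= n)%N.
Proof.
apply/(leq_trans (size_sum _ _ _))/bigmax_leqP => i _.
by rewrite mul_polyC (leq_trans (size_scale_leq _ _)) // size_polyXn.
Qed.

Lemma size_monic_form n (b : 'I_n -> P) :
  size ('X^n + \sum_(i < n) (b i)%:P * 'X^i) = n.+1.
Proof. by rewrite size_polyDl size_polyXn // ltnS size_tail. Qed.

Lemma monic_monic_form n (b : 'I_n -> P) :
  'X^n + \sum_(i < n) (b i)%:P * 'X^i \is monic.
Proof.
by rewrite monicE lead_coefDl ?lead_coefXn // size_polyXn ltnS size_tail.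
Qed.

Lemma monic_expansion f n : f \is monic -> size f = n.+1 ->
  f = 'X^n + \sum_(i < n) (f`_i)%:P * 'X^i.
Proof.
move=> /monicP; rewrite /lead_coef => fmon sf; rewrite sf /= in fmon.
rewrite -{1}[f]coefK sf poly_def big_ord_recr /= fmon scale1r addrC.
by congr (_ + _); apply: eq_bigr => i _; rewrite mul_polyC.
Qed.

Lemma monic_not_unit f g : f \is monic -> (1 < size f)%N -> 1 = f * g -> False.
Proof.
move=> fmon sf e; have g0 : g != 0.
  by apply/eqP => g0; move/eqP: e; rewrite g0 mulr0 oner_eq0.
have := congr1 (fun q : {poly P} => size q) e; rewrite size_poly1 size_monicM //.
by case: (size f) sf => [|[|m]] //= _; rewrite -size_poly_gt0 in g0;
  case: (size g) g0 => // l _; rewrite addnS.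
Qed.
End MonicPolynomials.

(** * Graded simplicity of the Poisson polynomial algebra *)

Section GrSimplicity.
Variables (k : fieldType) (Gamma : zmodType) (gamma : Gamma).
Variables (P : comAlgType k) (br : P -> P -> P) (G : Gamma -> set P).
Variables (alpha delta : P -> P) (brB : kpoly P -> kpoly P -> kpoly P).
Hypothesis hbr : poisson_bracket br.
Hypothesis hG : poisson_grading br G.
Hypothesis alpha_der : is_derivation alpha.
Hypothesis delta_der : is_derivation delta.
Hypothesis hcompat : compatible G gamma alpha delta.
Hypothesis hB : poisson_ore_bracket br alpha delta brB.
Let GB : Gamma -> set (kpoly P) := ore_grading G gamma.

Let sumG : direct_sum_decomposition G. Proof. by case: hG. Qed.
Let mulG rho tau a b : G rho a -> G tau b -> G (rho + tau) (a * b).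
Proof. by case: hG => _ h _; apply: h. Qed.
Let brG rho tau a b : G rho a -> G tau b -> G (rho + tau) (br a b).
Proof. by case: hG => _ _ h; apply: h. Qed.
Let sumGB : direct_sum_decomposition GB.
Proof. exact: ore_grading_direct_sum. Qed.
Let mulGB rho tau (p q : kpoly P) :
  GB rho p -> GB tau q -> GB (rho + tau) (p * q).
Proof. exact: ore_gradingM. Qed.
Let hP : poisson_bracket brB := ore_poisson hB.

Lemma gr_simple_base :
  poisson_gr_simple brB GB -> ad_poisson_gr_simple br G alpha delta.
Proof.
move=> simple I Ipois Igr Iad.
have [Iid _] := Ipois.
pose J : set (kpoly P) := [set p : {poly P} | forall n, I p`_n].
have Jpois : is_poisson_ideal brB J.
  exact: (coefficient_ideal_poisson hbr alpha_der delta_der hB Ipois Iad).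
have Jgr : is_graded_ideal GB J.
  apply: graded_idealP => //; first exact: (proj1 Jpois).
  move=> p c hc Jp tau n.
  have := graded_ideal_component sumG mulG Igr (decomposes_coef n hc) (Jp n)
    (tau - gamma *+ n).
  by rewrite subrK.
have constJ (a : P) : I a -> J a%:P.
  by move=> Ia n /=; rewrite coefC; case: ifP => _ //; case: Iid.
have [J0|JT] := simple J Jpois Jgr; [left | right].
  apply/seteqP; split=> [a /constJ|_ ->]; last by case: Iid.
  by rewrite J0 => /= /(congr1 (fun q : {poly P} => q`_0)); rewrite coefC coef0.
apply: ideal_eq_setT => //; have : J 1 by rewrite JT.
by move=> /(_ 0%N); rewrite /= coef1.
Qed.

(** For [a] of degree [tau], [delta(a)] has degree [gamma + tau], so only the
    component of [u] of degree [gamma] contributes to [{u, a} - u alpha(a)]. *)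
Lemma alpha_inner_homogeneous : alpha_inner br alpha delta ->
  exists2 u, G gamma u & forall a, delta a = br u a - u * alpha a.
Proof.
case=> u hu; have [c hc] := exists_decomposition sumG u.
exists (c gamma); first exact: (proj1 hc).
have brl a := derivationD (pbr_derivation_l hbr a).
apply: (homogeneous_ind sumG) => [|x y hx hy|tau a Ga].
- rewrite (derivation0 alpha_der) (derivation0 delta_der) mulr0 subr0.
  by rewrite (derivation0 (pbr_derivation_r hbr _)).
- rewrite (derivationD delta_der) (derivationD alpha_der) hx hy.
  by rewrite (derivationD (pbr_derivation_r hbr _)); ring.
have [aG dG] := hcompat tau.
have hda : decomposes G (delta a)
    (fun rho => br (c (rho - tau)) a - c (rho - tau) * alpha a).
  rewrite hu; apply: (decomposes_shift
    (F := fun x => inner_poisson_derivation br alpha x a) _ _ hc).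
    by move=> x y; rewrite /inner_poisson_derivation brl; ring.
  move=> sigma x Gx; apply: (pieceD sumG); first exact: brG.
  by apply/(pieceN sumG)/mulG => //; apply: aG; exists a.
have Gda : G (gamma + tau) (delta a) by apply: dG; exists a.
have := decomposition_unique sumG hda (decomposes_homogeneous sumG Gda)
  (gamma + tau).
by rewrite addrK eqxx.
Qed.

Lemma monic_normal_not_gr_simple (f : {poly P}) :
  f \is monic -> (1 < size f)%N -> homogeneous GB f -> poisson_normal brB f ->
  ~ poisson_gr_simple brB GB.
Proof.
move=> fmon sf Gf nf simple.
have [f0|[g hg]] := normal_generator_trivial hP simple Gf nf.
  by move: sf; rewrite [f]f0 size_poly0.
exact: monic_not_unit fmon sf hg.
Qed.

(** The witness is [f = t - u] with [u] homogeneous of degree [gamma]: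
    [{f, a} = alpha(a) f] and [{t, f} = - alpha(u) f]. *)
Lemma inner_not_gr_simple :
  alpha_inner br alpha delta -> ~ poisson_gr_simple brB GB.
Proof.
case/alpha_inner_homogeneous => u Gu hu.
apply: (@monic_normal_not_gr_simple ('X - u%:P)).
- exact: monicXsubC.
- by rewrite size_XsubC.
- exists gamma => -[|[|n]]; rewrite /= coefB coefX coefC /=.
  + by rewrite mulr0n subr0 sub0r; apply: (pieceN sumG).
  + by rewrite subr0 mulr1n subrr; apply: unit_homogeneous.
  + by rewrite subr0; apply: (piece0 sumG).
apply: (ore_bracket_in_ideal hB
  (I := principal ('X - u%:P : kpoly P))); first exact: principal_ideal.
  move=> a; exists (- (alpha a)%:P); rewrite (bracketC _ _ hP).
  rewrite [X in - X](derivationD (pbr_derivation_l hP _)).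
  rewrite (derivationN (pbr_derivation_l hP _)) (ore_var hB) (ore_extends hB) hu.
  by rewrite polyCB polyCM; ring.
exists (- (alpha u)%:P).
rewrite [LHS](derivationD (pbr_derivation_r hP _)).
rewrite (derivationN (pbr_derivation_r hP _)) (pbr_alternating hP).
rewrite (ore_var hB) hu (pbr_alternating hbr) !sub0r polyCN polyCM.
by ring.
Qed.

(** The leading coefficients of the elements of least degree form an ideal of
    [P] to which gr-simplicity applies. *)
Lemma minimal_degree_monic (I : set (kpoly P)) :
  poisson_gr_simple br G -> is_poisson_ideal brB I -> is_graded_ideal GB I ->
  I <> [set 0] ->
  exists f : {poly P}, [/\ I f, f \is monic, homogeneous GB f &
    forall g : {poly P}, I g -> (size g < size f)%N -> g = 0].
Proof.
move=> simple [Iid Ibr] Igr In0; have [I0 ID IM] := Iid.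
have exm : exists m, `[< exists p : {poly P}, [/\ I p, p != 0 & size p = m] >].
  apply: contrapT => no; apply: In0; apply/seteqP; split=> [p Ip|_ -> //].
  apply: contrapT => p0; apply: no; exists (size (p : {poly P})).
  by apply/asboolP; exists p; split=> //; apply/eqP.
case: (ex_minnP exm) => m /asboolP [p0 [Ip0 p0n0 sp0]] mmin.
have small (g : {poly P}) : I g -> (size g < m)%N -> g = 0.
  move=> Ig sg; apply: contrapT => /eqP g0; move: sg; rewrite ltnNge mmin //.
  by apply/asboolP; exists g.
have m0 : (0 < m)%N by rewrite -sp0 size_poly_gt0.
pose J : set P :=
  [set a | exists p : {poly P}, [/\ I p, (size p <= m)%N & p`_m.-1 = a]].
have Jid : is_ideal J.
  split=> [|_ _ [p [Ip sp <-]] [q [Iq sq <-]]|a _ [p [Ip sp <-]]].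
  - by exists 0; rewrite size_poly0 coef0.
  - exists (p + q); split; [exact: (ID) | | by rewrite coefD].
    by rewrite (leq_trans (size_polyD _ _)) // geq_max sp.
  - exists (a%:P * p); split; [exact: (IM) | | by rewrite coefCM].
    by rewrite mul_polyC (leq_trans (size_scale_leq _ _)).
have Jpois : is_poisson_ideal br J.
  split=> // a _ [p [Ip sp <-]].
  (* [{a, p}] has leading coefficient [{a, x} - (m - 1) alpha(a) x], where [x] is
     that of [p]; adding a multiple of [p] removes the second term. *)
  exists ((brB a%:P p : {poly P}) + (alpha a *+ m.-1)%:P * p); split.
  - by apply: (ID); [exact: Ibr | exact: IM].
  - apply/leq_sizeP => j hj; rewrite coefD coefCM (coef_bracket_const hbr hB).
    rewrite !(leq_sizeP _ _ sp) // ?(leq_trans hj) //.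
    rewrite !mul0rn !mul0r mulr0 addr0 !subr0.
    exact: derivation0 (pbr_derivation_r hbr _).
  rewrite coefD coefCM (coef_bracket_const hbr hB) prednK //.
  rewrite [p`_m](leq_sizeP _ _ sp) // mul0rn mul0r subr0 mulrnAl mulrnAl.
  by rewrite [_ * alpha a]mulrC subrK.
have Jgr : is_graded_ideal G J.
  apply: graded_idealP => // x c hc [p [Ip sp px]] tau; rewrite -px in hc.
  have [d hd] := exists_decomposition sumGB p.
  exists (d (tau + gamma *+ m.-1)); split.
  - exact: graded_ideal_component hd Ip _.
  - by apply: leq_trans sp; apply: decomposes_size hd.
  exact: (decomposition_unique sumG (decomposes_coef m.-1 hd) hc).
have J1 : J 1.
  have [J0|JT] := simple J Jpois Jgr; last by rewrite JT.
  have : J (lead_coef p0) by exists p0; rewrite /lead_coef sp0.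
  by rewrite J0 => /eqP; rewrite lead_coef_eq0 (negPf p0n0).
have [p [Ip sp p1]] := J1.
have [c hc] := exists_decomposition sumGB p.
(* The coefficient of [t^(m-1)] of this component has degree [0], so it is the
   component of degree [0] of [1], which is [1]. *)
pose f : {poly P} := c (gamma *+ m.-1).
have If : I f by apply: graded_ideal_component hc Ip _.
have sf : (size f <= m)%N by apply: leq_trans sp; apply: decomposes_size hc.
have f1 : f`_m.-1 = 1.
  have := decomposition_unique sumG (decomposes_coef m.-1 hc)
    (decomposes_homogeneous sumG (_ : G 0 p`_m.-1)) 0.
  rewrite p1 eqxx add0r; apply; exact: unit_homogeneous.
have sfm : size f = m.
  apply/eqP; rewrite eqn_leq sf -[m in (m <= _)%N]prednK // ltnNge.
  apply/negP => /leq_sizeP/(_ _ (leqnn _)); rewrite f1 => /eqP.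
  by rewrite oner_eq0.
exists f; split=> //; first by rewrite monicE /lead_coef sfm f1.
  by exists (gamma *+ m.-1); apply: (proj1 hc).
by rewrite sfm.
Qed.

(** Divide [{b, f}] by the monic polynomial [f]: the remainder lies in [I] and has
    degree less than that of [f], so it vanishes. *)
Lemma minimal_degree_normal (I : set (kpoly P)) (f : {poly P}) :
  is_poisson_ideal brB I -> I f -> f \is monic ->
  (forall g : {poly P}, I g -> (size g < size f)%N -> g = 0) ->
  poisson_normal brB f.
Proof.
move=> [Iid Ibr] If fmon fmin b; have [I0 ID IM] := Iid.
have e := Pdiv.RingMonic.rdivp_eq fmon (brB b f).
exists (Pdiv.CommonRing.rdivp (brB b f) f).
move: e; set q := Pdiv.CommonRing.rdivp _ _; set r := Pdiv.CommonRing.rmodp _ _.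
move=> e; suff r0 : r = 0 by rewrite [LHS]e r0 addr0 mulrC.
apply: fmin; last exact: Pdiv.CommonRing.ltn_rmodpN0 (monic_neq0 fmon).
have -> : r = brB b f - q * f by rewrite [brB b f]e addrC addKr.
by apply: (ID); [exact: Ibr | apply: ideal_opp (IM _ _ If)].
Qed.

Lemma gr_simple_or_monic_normal : poisson_gr_simple br G ->
  poisson_gr_simple brB GB \/
  exists f : {poly P}, [/\ f \is monic, (1 < size f)%N, homogeneous GB f &
    poisson_normal brB f].
Proof.
move=> simple; have [|no] := pselect (poisson_gr_simple brB GB); first by left.
right; apply: contrapT => nof; apply: no => I Ipois Igr.
have [|In0] := pselect (I = [set 0]); [by left | right].
have [f [If fmon Gf fmin]] := minimal_degree_monic simple Ipois Igr In0.
have nf := minimal_degree_normal Ipois If fmon fmin.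
have [sf|sf] := leqP (size f) 1; last by case: nof; exists f.
apply: ideal_eq_setT; first exact: (proj1 Ipois).
have f1 : f = 1.
  move: fmon; rewrite (size1_polyC sf) => /monicP; rewrite lead_coefC => ->.
  by [].
by rewrite -[X in I X]f1.
Qed.

(** Compare the two highest coefficients in [{a, f} = f c]. *)
Lemma monic_normal_inner (f : {poly P}) : [pchar k] =i pred0 ->
  f \is monic -> (1 < size f)%N -> poisson_normal brB f ->
  alpha_inner br alpha delta.
Proof.
move=> chark fmon; case sf: (size f) => [|[|n]] // _ nf.
have fn : f`_n.+1 = 1 by move/monicP: fmon; rewrite /lead_coef sf.
have fn1 : f`_n.+2 = 0 by rewrite nth_default ?sf.
have key a : delta a *+ n.+1 = br a f`_n + f`_n * alpha a.
  have [c hc] := nf a%:P.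
  (* [c] is a constant since [{a, f}] has degree at most that of the monic [f]. *)
  have [c0 hc0] : exists c0, (c : {poly P}) = c0%:P.
    exists (c : {poly P})`_0; apply: size1_polyC.
    have [->|cn0] := eqVneq (c : {poly P}) 0; first by rewrite size_poly0.
    have : (size (brB a%:P f : {poly P}) <= n.+2)%N.
      apply/leq_sizeP => j hj; rewrite (coef_bracket_const hbr hB).
      rewrite !(nth_default 0 (s := f)) ?sf ?(leq_trans hj) //.
      rewrite (derivation0 (pbr_derivation_r hbr _)).
      by rewrite !mul0rn !mul0r !subr0.
    by rewrite [brB _ _]hc size_monicM // sf !addSn /= ltnS -addn1 leq_add2l.
  have cf j : (brB a%:P f : {poly P})`_j = f`_j * c0.
    by rewrite [brB _ _]hc hc0 coefMC.
  have := cf n.+1; rewrite (coef_bracket_const hbr hB) fn fn1.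
  rewrite (derivation1 (pbr_derivation_r hbr _)) mul0rn mul0r subr0 sub0r mul1r.
  move=> c0E; have := cf n; rewrite (coef_bracket_const hbr hB) fn -c0E.
  move=> e; have -> : br a f`_n = f`_n *+ n * alpha a + 1 *+ n.+1 * delta a
      + f`_n * - (1 *+ n.+1 * alpha a) by rewrite -e; ring.
  by rewrite !mulrS; ring.
have n1 : (n.+1%:R : k) != 0 by rewrite (proj1 (GRing.pcharf0P k) chark).
exists (- (n.+1%:R^-1 *: f`_n)) => a; rewrite /inner_poisson_derivation.
rewrite (derivationN (pbr_derivation_l hbr _)).
rewrite (derivationZ _ _ (pbr_derivation_l hbr _)).
rewrite (bracketC _ _ hbr) scalerN opprK mulNr opprK -scalerAl -scalerDr -key.
by rewrite -scaler_nat scalerA mulVf // scale1r.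
Qed.

End GrSimplicity.

Theorem theorem4p3 (k : fieldType) (Gamma : zmodType) (gamma : Gamma)
    (P : comAlgType k) (br : P -> P -> P) (G : Gamma -> set P)
    (alpha delta : P -> P) (brB : kpoly P -> kpoly P -> kpoly P)
    (hbr : poisson_bracket br)
    (hG : poisson_grading br G)
    (halpha : poisson_derivation br alpha)
    (hdelta : poisson_alpha_derivation br alpha delta)
    (hcompat : compatible G gamma alpha delta)
    (hB : poisson_ore_bracket br alpha delta brB) :
  let GB := ore_grading G gamma in
  [/\ poisson_gr_simple brB GB ->
        ad_poisson_gr_simple br G alpha delta /\ ~ alpha_inner br alpha delta,
      poisson_gr_simple br G ->
        (poisson_gr_simple brB GB <->
         ~ exists (n : nat) (b : 'I_n -> P),
             let f : kpoly P := ('X^n + \sum_(i < n) (b i)%:P * 'X^i)%R in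
             [/\ (1 <= n)%N, homogeneous GB f & poisson_normal brB f]) &
      poisson_gr_simple br G -> [pchar k] =i pred0 ->
        (poisson_gr_simple brB GB <-> ~ alpha_inner br alpha delta)].
Proof.
move=> GB; have [alpha_der _] := halpha; have [delta_der _] := hdelta.
have notinner : poisson_gr_simple brB GB -> ~ alpha_inner br alpha delta.
  move=> simple inner.
  exact: (inner_not_gr_simple hbr hG alpha_der delta_der hcompat hB inner).
have dichotomy := gr_simple_or_monic_normal gamma hbr hG hB.
split=> [simple|simpleP|simpleP chark].
- split; last exact: notinner.
  exact: (gr_simple_base hbr hG alpha_der delta_der hB simple).
- split=> [simple [n [b [n1 Gf nf]]]|nof].
    apply: (monic_normal_not_gr_simple hB (monic_monic_form b) _ Gf nf simple).
    by rewrite size_monic_form.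
  have [//|[f [fmon sf Gf nf]]] := dichotomy simpleP; case: nof.
  exists (size f).-1, (fun i => f`_i).
  have <- : f = 'X^((size f).-1) + \sum_(i < (size f).-1) (f`_i)%:P * 'X^i.
    by apply: monic_expansion => //; rewrite prednK // ltnW.
  by split=> //; rewrite -ltnS prednK // ltnW.
split=> [/notinner //|ninner].
have [//|[f [fmon sf _ nf]]] := dichotomy simpleP; case: ninner.
exact: (monic_normal_inner hbr hB chark fmon sf nf).
Qed.
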